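(* Let $\gamma$ be the Euler-Mascheroni constant. Then $$\frac{4^{\gamma}}{2^{\ln 2}} = \frac{\sqrt{2}}{1}\cdot\frac{\sqrt{2}}{\sqrt[3]{3}}\cdot\frac{\sqrt[4]{4}}{\sqrt[3]{3}}\cdot\frac{\sqrt[4]{4}}{\sqrt[5]{5}}\cdot\frac{\sqrt[6]{6}}{\sqrt[5]{5}}\cdot\frac{\sqrt[6]{6}}{\sqrt[7]{7}}\cdots = \lim_{N\to\infty}\prod_{k=1}^{N}\left(\frac{(k+1)^{1/(k+1)}}{k^{1/k}}\right)^{(-1)^{k+1}}.$$
   Context: The Euler-Mascheroni constant is $\gamma=\lim_{n\to\infty}\left(\sum_{k=1}^n \frac1k-\ln n\right)$. The infinite product is the limit of its partial products, taken factor by factor in the displayed order. *)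

(* Defs.v *)
From mathcomp Require Import all_boot all_order all_algebra.
From mathcomp Require Import all_classical all_reals all_analysis.

Set Implicit Arguments.
Unset Strict Implicit.
Unset Printing Implicit Defensive.

Import Order.TTheory GRing.Theory Num.Theory.
Import numFieldNormedType.Exports.

Local Open Scope classical_set_scope.
Local Open Scope ring_scope.

Definition euler_mascheroni (R : realType) : R :=
  limn (fun n : nat => (\sum_(1 <= k < n.+1) (k%:R : R)^-1) - ln (n%:R : R)).

(* The n-th root of n, for n >= 1. *)
Definition self_root (R : realType) (n : nat) : R :=
  (n%:R : R) `^ (n%:R^-1).

(* The k-th factor (k >= 1) of
     2^(1/2)/1 * 2^(1/2)/3^(1/3) * 4^(1/4)/3^(1/3) * 4^(1/4)/5^(1/5) * ...
   For k = 1, 2, 3, 4, 5, ... the index in the numerator runs through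
   2, 2, 4, 4, 6, ... and the one in the denominator through 1, 3, 3, 5, 5, ... *)
Definition root_factor (R : realType) (k : nat) : R :=
  self_root R (uphalf k).*2 / self_root R (k./2).*2.+1.

(* Main.v *)
Require Import Defs.
From mathcomp Require Import all_boot all_order all_algebra.
From mathcomp Require Import all_classical all_reals all_analysis.
From mathcomp Require Import ring lra.

Import Order.TTheory GRing.Theory Num.Theory.
Import numFieldNormedType.Exports.

Local Open Scope classical_set_scope.
Local Open Scope ring_scope.

(** Write b k = ln k / k for the logarithm of the k-th root of k.  The k-th
    factor is the exponential of (-1)^(k+1) (b (k+1) - b k), so every term b k
    with 2 <= k <= N occurs twice, with sign (-1)^k, in the logarithm of the
    N-th partial product: that logarithm is 2 A_N + (-1)^(N+1) b (N+1), where
    A_N is the sum of the (-1)^k b k for k <= N ([prod_root_factorE]).  As b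
    tends to 0 ([cvg_ln_div]), only the limit of A_N has to be found.

    Let H n be the harmonic numbers and B n the sum of the b k for k <= n.
    Since 2 b (2 k) = ln 2 / k + b k, adding twice the even terms to - B (2 n)
    gives A_(2n) = ln 2 H n + B n - B (2 n) ([alt_sum_double]).  Now H n - ln n
    tends to gamma, and B n - (ln n)^2 / 2 converges, to a limit that cancels in
    B n - B (2 n); both convergences are instances of the comparison of a sum
    with an integral ([cvg_sum_sub_primitive]).  What is left is
      ln 2 ln n + (ln n)^2 / 2 - (ln n + ln 2)^2 / 2 = - (ln 2)^2 / 2,
    so A_N tends to gamma ln 2 - (ln 2)^2 / 2 and the product tends to
    exp (2 gamma ln 2 - (ln 2)^2) = 4^gamma / 2^(ln 2). *)

Lemma mean_value_sandwich (R : realType) (F f : R -> R) (a b : R) :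
  a <= b ->
  (forall x : R, a <= x -> x <= b -> is_derive x 1 F (f x)) ->
  (forall x y : R, a <= x -> x <= y -> y <= b -> f y <= f x) ->
  f b * (b - a) <= F b - F a <= f a * (b - a).
Proof.
move=> ab dF fdecr.
have [||c /[!in_itv]/= /andP[ac cb] ->] := @MVT_segment R F f a b ab.
- by move=> x /[!in_itv]/= /andP[/ltW ax /ltW xb]; exact: dF.
- apply: derivable_within_continuous => x /[!in_itv]/= /andP[ax xb].
  by have [] := dF x ax xb.
have ba0 : 0 <= b - a by rewrite subr_ge0.
by rewrite !ler_wpM2r// fdecr.
Qed.

(** The Maclaurin-Cauchy comparison: the mean value theorem on [n, n + 1] puts
    F (n + 1) - F n between f (n + 1) and f n.  The left bound makes the
    sequence decrease; the right one makes its difference with f n increase,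
    so that f >= 0 yields a lower bound.  All this takes place from m on, since
    ln x / x decreases only from e on. *)
Lemma cvg_sum_sub_primitive (R : realType) (F f : R -> R) (m : nat) :
  (forall x : R, m%:R <= x -> is_derive x 1 F (f x)) ->
  (forall x y : R, m%:R <= x -> x <= y -> f y <= f x) ->
  (forall x : R, m%:R <= x -> 0 <= f x) ->
  cvgn (fun n => \sum_(1 <= k < n.+1) f k%:R - F n%:R : R).
Proof.
move=> dF fdecr f0.
pose D n : R := \sum_(1 <= k < n.+1) f k%:R - F n%:R; rewrite -/D.
have step n : f (n + m).+1%:R <= F (n + m).+1%:R - F (n + m)%:R <= f (n + m)%:R.
  have le_m : m%:R <= (n + m)%:R :> R by rewrite ler_nat leq_addl.
  have := @mean_value_sandwich R F f (n + m)%:R (n + m).+1%:R.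
  rewrite -natrB ?leqnSn// subSnn !mulr1; apply.
  - by rewrite ler_nat.
  - by move=> x nx _; apply: dF; apply: le_trans nx.
  - by move=> x y nx xy _; apply: fdecr => //; apply: le_trans nx.
have DS n : D (n.+1 + m)%N =
    D (n + m)%N + (f (n + m).+1%:R - (F (n + m).+1%:R - F (n + m)%:R)).
  by rewrite /D addSn big_nat_recr//=; ring.
have Ddecr n : D (n.+1 + m)%N <= D (n + m)%N.
  by rewrite DS; have /andP[+ _] := step n; lra.
suff /cvg_ex[l Dl] : cvgn [sequence D (n + m)%N]_n.
  by apply/cvg_ex; exists l; rewrite -(@cvg_shiftn m).
apply: nonincreasing_is_cvgn; first exact/nonincreasing_seqP.
(* the increment of D n - f n is f n - (F (n + 1) - F n) *)
have lb n : D m - f m%:R <= D (n + m)%N - f (n + m)%:R.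
  elim: n => [//|n]; rewrite DS addSn.
  by have /andP[_ +] := step n; lra.
exists (D m - f m%:R) => _ [n _ <-] /=.
have := lb n; have : 0 <= f (n + m)%:R by apply: f0; rewrite ler_nat leq_addl.
by lra.
Qed.

(** [limn] has a meaning only for a convergent sequence, so the convergence to
    the constant has a content beyond its definition. *)
Lemma cvg_harmonic_sub_ln (R : realType) :
  (\sum_(1 <= k < n.+1) (k%:R : R)^-1 - ln (n%:R : R)) @[n --> \oo]
    --> euler_mascheroni R.
Proof.
apply: (@cvg_sum_sub_primitive R (@ln R) (fun x => x^-1) 1).
- by move=> x x1; apply: is_derive1_ln; exact: lt_le_trans x1.
- by move=> x y x1 xy; rewrite lef_pV2 ?posrE; lra.
- by move=> x x1; rewrite invr_ge0; lra.
Qed.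

(** An integer beyond e is needed; 4 is convenient, because
    ln 4 = - 2 ln (1 - 1 / 2) and ln (1 + x) <= x. *)
Lemma ln4_ge1 (R : realType) : 1 <= ln 4 :> R.
Proof.
have -> : ln 4 = - 2 * ln (1 - 2^-1) :> R.
  have -> : 4 = (1 - 2^-1) ^- 2 :> R by field.
  have h0 : 0 < 1 - 2^-1 :> R by lra.
  by rewrite lnV ?posrE ?exprn_gt0// lnXn// mulNr mulr_natl.
have /(@le_ln1Dx R) : -1 < - 2^-1 :> R by lra.
by lra.
Qed.

(** With y = x (1 + t), one has ln y <= ln x + t <= ln x + t ln x
    = (y / x) ln x, the second inequality because 1 <= ln x. *)
Lemma ln_div_nonincreasing (R : realType) (x y : R) :
  0 < x -> 1 <= ln x -> x <= y -> ln y / y <= ln x / x.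
Proof.
move=> x0 lx xy; have y0 : 0 < y by apply: lt_le_trans xy.
rewrite ler_pdivrMr// mulrAC -mulrA.
have -> : y = x * (1 + (y / x - 1)) by field; rewrite gt_eqF.
have yx1 : 0 <= y / x - 1 by rewrite subr_ge0 ler_pdivlMr// mul1r.
set t := y / x - 1 in yx1 *.
rewrite lnM ?posrE//; last by lra.
have -> : x * (1 + t) / x = 1 + t by field; rewrite gt_eqF.
have : ln (1 + t) <= t by apply: le_ln1Dx; lra.
have : t * 1 <= t * ln x by rewrite ler_wpM2l.
by lra.
Qed.

Lemma is_cvg_sum_ln_div (R : realType) :
  cvgn (fun n : nat => \sum_(1 <= k < n.+1) (ln k%:R / k%:R) -
                       (ln (n%:R : R)) ^+ 2 / 2).
Proof.
have ln_ge1 (x : R) : 4 <= x -> 1 <= ln x.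
  move=> x4; apply: le_trans (ln4_ge1 R) _.
  by rewrite ler_ln ?posrE//; lra.
apply: (@cvg_sum_sub_primitive R (fun x => ln x ^+ 2 / 2)
          (fun x => ln x / x) 4).
- move=> x x4.
  have dln : is_derive x 1 (@ln R) x^-1 by apply: is_derive1_ln; lra.
  have -> : (fun x => ln x ^+ 2 / 2) = 2^-1 *: (@ln R) ^+ 2.
    by apply/funext => z; rewrite fctE mulrC.
  by apply: is_derive_eq; rewrite /GRing.scale/=; field; rewrite gt_eqF//; lra.
- move=> x y x4 xy; apply: ln_div_nonincreasing => //; first lra.
  exact: ln_ge1.
- move=> x x4; apply: divr_ge0; last lra.
  exact: le_trans (ln_ge1 _ x4).
Qed.

(** From ln x = 2 ln (sqrt x) <= 2 sqrt x. *)
Lemma cvg_ln_div (R : realType) : ln (n%:R : R) / n%:R @[n --> \oo] --> (0 : R).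
Proof.
have sqrt0 : 2 * Num.sqrt (@harmonic R n) @[n --> \oo] --> (0 : R).
  have -> : 0 = 2 * Num.sqrt 0 :> R by rewrite sqrtr0 mulr0.
  apply: cvgM => /=; first exact: cvg_cst.
  by apply: (cvg_comp _ _ (@cvg_harmonic R)); exact: sqrt_continuous.
rewrite -(@cvg_shiftS R^o) /=.
apply: (@squeeze_cvgr _ _ _ _ (fun=> 0) _ _ _ _ (cvg_cst _) sqrt0).
apply: nearW => n; set x : R := n.+1%:R.
have x0 : 0 < x by rewrite ltr0n.
have s0 : 0 < Num.sqrt x by rewrite sqrtr_gt0.
apply/andP; split; first by rewrite divr_ge0 ?ln_ge0 ?ler1n ?ltW.
have -> : ln x = 2 * ln (Num.sqrt x)
  by rewrite -{1}(sqr_sqrtr (ltW x0)) lnXn// mulr_natl.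
rewrite (_ : harmonic n = x^-1)// sqrtrV ?(ltW x0)// -mulrA.
rewrite ler_pM2l// ler_pdivrMr//.
rewrite -[X in _ * X](sqr_sqrtr (ltW x0)) expr2 mulKf ?gt_eqF//.
by rewrite ltW// ln_sublinear.
Qed.

Definition log_root (R : realType) (k : nat) : R := ln k%:R / k%:R.

(** This includes k = 0, where both sides are 1. *)
Lemma self_rootE (R : realType) (k : nat) :
  self_root R k = expR (log_root R k).
Proof.
rewrite /self_root /powR /log_root; case: eqP => [->|_].
  by rewrite invr0 eqxx mulr0 expR0.
by rewrite mulrC.
Qed.

(** The even index of the k-th factor, always in the numerator, is k + 1 for odd
    k and k for even k; the sign in the exponent records the swap. *)
Lemma root_factorE (R : realType) (k : nat) :
  root_factor R k =
  (self_root R k.+1 / self_root R k) ^ ((-1) ^+ k.+1 : int).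
Proof.
rewrite /root_factor -signr_odd /=; case: (boolP (odd k)) => ko /=.
  by rewrite odd_uphalfK// odd_halfK// prednK ?odd_gt0// expr0 expr1z.
by rewrite even_uphalfK// even_halfK// expr1 exprN1 invf_div.
Qed.

Definition alt_sum (R : realType) (N : nat) : R :=
  \sum_(1 <= k < N.+1) (-1) ^+ k * log_root R k.

Lemma alt_sumS (R : realType) (N : nat) :
  alt_sum R N.+1 = alt_sum R N + (-1) ^+ N.+1 * log_root R N.+1.
Proof. by rewrite /alt_sum big_nat_recr. Qed.

Lemma prod_root_factorE (R : realType) (N : nat) :
  \prod_(1 <= k < N.+1) root_factor R k =
  expR (2 * alt_sum R N + (-1) ^+ N.+1 * log_root R N.+1).
Proof.
elim: N => [|N IH].
  by rewrite /alt_sum !big_geq// /log_root ln1 mul0r !mulr0 addr0 expR0.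
have expR_sign (x : R) : expR x ^ ((-1) ^+ N.+2 : int) =
    expR ((-1) ^+ N.+2 * x).
  rewrite -signr_odd -[in RHS]signr_odd; case: (odd _).
    by rewrite !expr1 mulN1r exprN1 expRN.
  by rewrite !expr0 mul1r expr1z.
rewrite big_nat_recr//= IH root_factorE !self_rootE -expRB expR_sign -expRD.
congr expR; rewrite alt_sumS [in (-1) ^+ N.+2]exprS; ring.
Qed.

Lemma log_root_double (R : realType) (n : nat) :
  2 * log_root R n.+1.*2 = ln 2 / n.+1%:R + log_root R n.+1.
Proof.
have n0 : n.+1%:R != 0 :> R by rewrite pnatr_eq0.
rewrite /log_root -muln2 natrM mulrC lnM ?posrE ?ltr0n//.
by field.
Qed.

Lemma alt_sum_double (R : realType) (n : nat) :
  alt_sum R n.*2 = ln 2 * (\sum_(1 <= k < n.+1) (k%:R : R)^-1) +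
    \sum_(1 <= k < n.+1) log_root R k - \sum_(1 <= k < n.*2.+1) log_root R k.
Proof.
elim: n => [|n IH]; first by rewrite /alt_sum !big_geq// mulr0 addr0 subr0.
have sumS (f : nat -> R) m :
    \sum_(1 <= k < m.+2) f k = \sum_(1 <= k < m.+1) f k + f m.+1.
  by rewrite big_nat_recr.
rewrite doubleS !alt_sumS IH !(sumS _ n) (sumS _ n.*2.+1) (sumS _ n.*2).
have -> : log_root R n.+1 = 2 * log_root R n.*2.+2 - ln 2 / n.+1%:R.
  by rewrite -doubleS log_root_double; ring.
by rewrite !exprS -signr_odd odd_double; ring.
Qed.

(** The limit l of B n - (ln n)^2 / 2 cancels against itself along 2 n. *)
Lemma cvg_alt_sum_double (R : realType) :
  alt_sum R n.*2 @[n --> \oo]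
    --> ln 2 * euler_mascheroni R - ln 2 ^+ 2 / 2.
Proof.
have /cvg_ex[/= l Dl] := is_cvg_sum_ln_div R.
set D := (D in D @ _ --> _) in Dl.
have D2l : D n.*2 @[n --> \oo] --> l.
  under eq_fun do rewrite -muln2.
  by apply: (cvg_comp _ _ _ Dl); exact: cvg_mulnr.
have -> : ln 2 * euler_mascheroni R - ln 2 ^+ 2 / 2 =
    ln 2 * euler_mascheroni R + (l - l) - ln 2 ^+ 2 / 2 :> R by ring.
have lim := cvgB (cvgD (cvgM (cvg_cst (ln 2 : R)) (@cvg_harmonic_sub_ln R))
                       (cvgB Dl D2l))
                 (cvg_cst (ln 2 ^+ 2 / 2 : R)).
apply: cvg_trans; last exact: lim.
apply: near_eq_cvg; near=> n.
(* ln (2 n) = ln 2 + ln n fails at n = 0 *)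
have n0 : 0 < n%:R :> R by rewrite ltr0n; near: n; exact: nbhs_infty_gt.
rewrite alt_sum_double /D !fctE /=.
have -> : ln n.*2%:R = ln n%:R + ln 2 :> R.
  by rewrite -muln2 natrM lnM ?posrE.
by rewrite /log_root; field.
Unshelve. all: by end_near. Qed.

(** A_N differs from A at the largest even integer up to N by at most its
    last term, which vanishes in the limit; this covers both parities at once. *)
Lemma cvg_alt_sum (R : realType) :
  alt_sum R N @[N --> \oo] --> ln 2 * euler_mascheroni R - ln 2 ^+ 2 / 2.
Proof.
have halfy : N./2 @[N --> \oo] --> \oo.
  by under eq_fun do rewrite -divn2; exact: cvg_divnr.
have odd0 : (odd N)%:R * log_root R N @[N --> \oo] --> (0 : R).
  apply: (@squeeze_cvgr _ _ _ _ (fun=> 0) (log_root R) _ _ _ (cvg_cst _));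
    last exact: cvg_ln_div.
  apply: nearW => N.
  have b0 : 0 <= log_root R N.
    case: N => [|N]; first by rewrite /log_root invr0 mulr0.
    by rewrite divr_ge0// ln_ge0// ler1n.
  by case: (odd N); rewrite ?mul1r ?mul0r lexx b0.
rewrite -[X in _ --> X]subr0.
have -> : alt_sum R = fun N => alt_sum R N./2.*2 - (odd N)%:R * log_root R N.
  apply/funext => N; case: (boolP (odd N)) => oN; last first.
    by rewrite even_halfK// mul0r subr0.
  rewrite mul1r odd_halfK//; case: N oN => // n on.
  by rewrite alt_sumS -signr_odd on expr1 mulN1r.
apply: cvgB odd0; exact: (cvg_comp _ _ halfy (@cvg_alt_sum_double R)).
Qed.

Theorem mainTheorem2 (R : realType) :
  (\prod_(1 <= k < N.+1) root_factor R k @[N --> \oo]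
     --> (4 `^ euler_mascheroni R / 2 `^ ln 2 : R)) /\
  (\prod_(1 <= k < N.+1)
     ((k.+1%:R `^ (k.+1%:R^-1) / k%:R `^ (k%:R^-1)) ^ ((-1) ^+ k.+1 : int) : R)
     @[N --> \oo]
     --> (4 `^ euler_mascheroni R / 2 `^ ln 2 : R)).
Proof.
suff lim : \prod_(1 <= k < N.+1) root_factor R k @[N --> \oo]
     --> (4 `^ euler_mascheroni R / 2 `^ ln 2 : R).
  split=> //; under eq_fun do under eq_bigr do rewrite -[_ ^ _]root_factorE.
  exact: lim.
have sign0 : (-1) ^+ N.+1 * log_root R N.+1 @[N --> \oo] --> (0 : R).
  have b0 : log_root R N.+1 @[N --> \oo] --> (0 : R).
    by rewrite (@cvg_shiftS R^o (log_root R)); exact: cvg_ln_div.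
  apply/norm_cvg0P; under eq_fun do rewrite normrM normr_sign mul1r.
  by rewrite -(normr0 R); apply: cvg_norm b0.
have -> : 4 `^ euler_mascheroni R / 2 `^ ln 2 =
    expR (2 * (ln 2 * euler_mascheroni R - ln 2 ^+ 2 / 2) + 0) :> R.
  rewrite /powR !pnatr_eq0 /= -expRB; congr expR.
  have -> : 4 = 2 ^+ 2 :> R by ring.
  by rewrite lnXn//; field.
under eq_fun do rewrite prod_root_factorE.
have lim : 2 * alt_sum R N + (-1) ^+ N.+1 * log_root R N.+1 @[N --> \oo]
    --> 2 * (ln 2 * euler_mascheroni R - ln 2 ^+ 2 / 2) + 0.
  by apply: cvgD sign0; apply: cvgM; [exact: cvg_cst|exact: cvg_alt_sum].
exact: (cvg_comp _ _ lim (@continuous_expR R _)).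
Qed.
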